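(* There exists a (single-peaked) instance $I=\langle \mathcal{N},\mathcal{R},L,\pi^0\rangle$ for which there is an allocation $\pi$ that Pareto-dominates $\pi^0$ and that cannot be reached from $\pi^0$ by a sequence of improving swap-deals.
   Context: Housing market: an instance is $I=\langle \mathcal{N},\mathcal{R},L,\pi^0\rangle$ with $\mathcal{N}$ a set of $n$ agents, $\mathcal{R}$ a set of $n$ resources, $L$ a profile of strict linear orders $\succ_i$ over $\mathcal{R}$, one for each agent $a_i$, and $\pi^0$ an initial allocation; an allocation $\pi$ is a bijective assignment of one resource $\pi_{a_i}$ to each agent $a_i$. The instance is single-peaked if there is a linear order $\lhd$ over $\mathcal{R}$ such that for every agent $a_i$ with top resource $t_i$ and all resources $r,r'$, if $r'\lhd r\lhd t_i$ or $t_i\lhd r\lhd r'$ then $r\succ_i r'$. An allocation $\pi'$ Pareto-dominates $\pi$ if every agent $a_i$ has $\pi'_{a_i}\succ_i\pi_{a_i}$ or $\pi'_{a_i}=\pi_{a_i}$, with $\pi'_{a_j}\succ_j\pi_{a_j}$ for at least one agent $a_j$. A swap-deal between two distinct agents exchanges the resources they currently hold; it is improving if both agents strictly prefer the resource they receive to the one they give away. *)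

(* Defs.v *)
From mathcomp Require Import all_boot all_fingroup.
Set Implicit Arguments.
Unset Strict Implicit.
Unset Printing Implicit Defensive.

Definition strict_linear_order (T : eqType) (r : rel T) : Prop :=
  [/\ irreflexive r, transitive r & forall x y, x != y -> r x y || r y x].

(* An allocation is a finite function from agents to resources that is
   [bijective]; bijectivity is required separately wherever it is needed. *)
Record housing_market := HousingMarket {
  agent : finType;
  resource : finType;
  card_agent_resource : #|agent| = #|resource|;
  (* [prefers a r r'] : agent [a] strictly prefers [r] to [r'] *)
  prefers : agent -> rel resource;
  prefers_linear : forall a, strict_linear_order (prefers a);
  initial : {ffun agent -> resource};
  initial_bij : bijective initial
}.

Definition is_top (I : housing_market) (a : agent I) (t : resource I) : Prop :=
  forall r, r != t -> prefers a t r.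

Definition single_peaked_wrt (I : housing_market) (lhd : rel (resource I)) :
    Prop :=
  forall (a : agent I) (t : resource I), is_top a t ->
  forall r r' : resource I,
    (lhd r' r /\ lhd r t) \/ (lhd t r /\ lhd r r') -> prefers a r r'.

Definition single_peaked (I : housing_market) : Prop :=
  exists lhd : rel (resource I),
    strict_linear_order lhd /\ single_peaked_wrt lhd.

Definition pareto_dominates (I : housing_market)
    (pi' pi : {ffun agent I -> resource I}) : Prop :=
  (forall a, prefers a (pi' a) (pi a) \/ pi' a = pi a) /\
  (exists a, prefers a (pi' a) (pi a)).

Definition swap (I : housing_market) (pi : {ffun agent I -> resource I})
    (a b : agent I) : {ffun agent I -> resource I} :=
  [ffun c => pi (tperm a b c)].

Definition improving_swap_deal (I : housing_market) :
    rel {ffun agent I -> resource I} :=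
  fun pi pi' => [exists a, exists b,
    [&& a != b, prefers a (pi b) (pi a), prefers b (pi a) (pi b)
      & pi' == swap pi a b]].

Definition reachable (I : housing_market)
    (pi pi' : {ffun agent I -> resource I}) : bool :=
  connect (@improving_swap_deal I) pi pi'.

(* Main.v *)
(** Three agents initially hold the resources 0, 1, 2 of the same index.
    Agents 0 and 2 rank 1 > 0 > 2 and agent 1 ranks 2 > 1 > 0, which is
    single-peaked for 0 < 1 < 2. Giving 1, 2, 0 to agents 0, 1, 2 is a Pareto
    improvement, but the only improving deal is the one between agents 1 and 2;
    both then hold their favourite resource, so no further deal is possible and
    agent 0 keeps resource 0. *)
Require Import Defs.
From mathcomp Require Import all_boot all_fingroup.

(** Best resource first; the entries are natural numbers so that [index] evaluates on concrete
    values. *)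
Definition ranking (a : 'I_3) : seq nat :=
  if val a == 1 then [:: 2; 1; 0] else [:: 1; 0; 2].

Definition ranked_before (a : 'I_3) : rel 'I_3 :=
  fun r r' => index (val r) (ranking a) < index (val r') (ranking a).

Lemma ranked_before_linear (a : 'I_3) : strict_linear_order (ranked_before a).
Proof.
split=> [r|r' r r''|r r']; rewrite /ranked_before ?ltnn //; first exact: ltn_trans.
rewrite -neq_ltn; apply: contra_neq => eq_rr'; apply: val_inj.
(* Equal indices identify two resources only if both occur in the list, as [index] sends every
   absent value to the size of the list. *)
have ranked (s : 'I_3) : val s \in ranking a.
  by case: s => [[|[|[|s]]] ?] //; rewrite /ranking; case: (val a == 1).
exact: (index_inj 0 (ranked r) (ranked r') eq_rr').
Qed.

Definition own : {ffun 'I_3 -> 'I_3} := [ffun a => a].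

Lemma own_bij : bijective own.
Proof. by exists id => a; rewrite ffunE. Qed.

Definition market : housing_market :=
  @HousingMarket 'I_3 'I_3 erefl ranked_before ranked_before_linear own own_bij.

Definition favourite (a : 'I_3) : 'I_3 := inord (head 0 (ranking a)).

(** Any other top would have to precede the head of the ranking, which has index 0. *)
Lemma is_top_favourite (a t : 'I_3) : @is_top market a t -> t = favourite a.
Proof.
move=> top_t; apply/eqP; apply: contraT; rewrite eq_sym => /top_t /=.
rewrite /ranked_before /favourite /ranking.
by case: (val a == 1); rewrite /= inordK.
Qed.

Lemma market_single_peaked : single_peaked market.
Proof.
exists (fun r r' : 'I_3 => r < r'); split.
  split=> [r|r' r r''|r r']; [exact: ltnn | exact: ltn_trans |].
  by rewrite -neq_ltn.
move=> a t /is_top_favourite -> r r' /=.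
rewrite /favourite /ranked_before /ranking.
(* Once the peak is the constant 2 or 1, all pairs of resources are checked. *)
case: (val a == 1); rewrite /= inordK //.
  by case: r r' => [[|[|[|r]]] ?] // [[|[|[|r']]] ?] //= [] [].
by case: r r' => [[|[|[|r]]] ?] // [[|[|[|r']]] ?] //= [] [].
Qed.

Definition agent0 : 'I_3 := inord 0.
Definition agent1 : 'I_3 := inord 1.
Definition agent2 : 'I_3 := inord 2.

Lemma agentP (a : 'I_3) : [\/ a = agent0, a = agent1 | a = agent2].
Proof.
case: a => [[|[|[|a]]] lt_a3] //;
  [constructor 1 | constructor 2 | constructor 3];
  by apply: val_inj; rewrite /= inordK.
Qed.

Definition dealt : {ffun 'I_3 -> 'I_3} := @swap market own agent1 agent2.

Lemma ranked_beforeF (a r : 'I_3) : ranked_before a r (favourite a) = false.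
Proof.
by rewrite /ranked_before /favourite /ranking; case: (val a == 1);
  rewrite /= inordK.
Qed.

(** Agent 1 refuses resource 0 and agent 0 refuses resource 2, which rules out every deal involving
    agent 0. *)
Lemma deal_from_own (pi : {ffun 'I_3 -> 'I_3}) :
  @improving_swap_deal market own pi -> pi = dealt.
Proof.
case/existsP=> a /existsP[b /and4P[]]; rewrite /= !ffunE.
case: (agentP a) => ->; case: (agentP b) => -> //;
  rewrite ?eqxx // /ranked_before /ranking /= !inordK //= => _ _ _ /eqP-> //.
(* What remains is the same deal with its two agents named in the order 2, 1. *)
by apply/ffunP=> c; rewrite !ffunE tpermC.
Qed.

(** Two distinct agents always include agent 1 or agent 2, who cannot improve on a favourite. *)
Lemma no_deal_from_dealt (pi : {ffun 'I_3 -> 'I_3}) :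
  ~~ @improving_swap_deal market dealt pi.
Proof.
have fav1 : dealt agent1 = favourite agent1.
  by rewrite !ffunE tpermL /favourite /ranking /= inordK.
have fav2 : dealt agent2 = favourite agent2.
  by rewrite !ffunE tpermR /favourite /ranking /= inordK.
apply/existsP=> -[a /existsP[b /and4P[]]] /=.
by case: (agentP a) => ->; case: (agentP b) => ->;
  rewrite ?eqxx // ?fav1 ?fav2 ?ranked_beforeF.
Qed.

Lemma reachable_from_own (pi : {ffun 'I_3 -> 'I_3}) :
  @reachable market own pi -> pi = own \/ pi = dealt.
Proof.
case/connectP=> [[|pi1 [|pi2 p]]] /=; first by move=> _ ->; left.
  by rewrite andbT => /deal_from_own -> ->; right.
by case/and3P=> /deal_from_own-> deal; case/negP: (no_deal_from_dealt pi2).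
Qed.

Definition rotated : {ffun 'I_3 -> 'I_3} := [ffun a => ordS a].

Theorem proposition4 :
  exists I : housing_market,
    single_peaked I /\
    exists pi : {ffun agent I -> resource I},
      [/\ bijective pi,
          pareto_dominates pi (initial I) &
          ~ reachable (initial I) pi].
Proof.
exists market; split; first exact: market_single_peaked.
exists rotated; split.
- by exists (@ord_pred 3) => a; rewrite ffunE ?ordSK ?ord_predK.
- have better a : @prefers market a (rotated a) (own a).
    by rewrite /= !ffunE; case: a => [[|[|[|a]]] ?].
  by split=> [a|]; [left | exists agent0].
(* Agent 0 tells the allocations apart: it gets 1 in [rotated] but 0 in both [own] and [dealt]. *)
- move=> /reachable_from_own[] /ffunP/(_ agent0)/(congr1 val);
    rewrite !ffunE ?tpermD /= ?inordK //;
    by rewrite -val_eqE /= !inordK.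
Qed.
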